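(* There is a function $\varepsilon:\mathbb{N}\to\mathbb{R}$ with $\varepsilon(r)\to 0$ as $r\to\infty$ such that for every $r\in\mathbb{N}$, $(1+\varepsilon(r))r$ is a positive integer and $\mathrm{B}(r)\leq \mathrm{Tow}\big((1+\varepsilon(r))r\big)$. That is, $\mathrm{B}(r)\leq\mathrm{Tow}((1+o(1))r)$.
   Context: For $r\in\mathbb{N}$, the Brauer number $\mathrm{B}(r)$ is the smallest positive integer $N$ such that every colouring of $\{1,2,\dots,N\}$ with $r$ colours contains a monochromatic set of the form $\{x,d,x+d,x+2d\}$ with $x,d\in\mathbb{N}$. The tower function is defined by $\mathrm{Tow}(1)=2$ and $\mathrm{Tow}(n)=2^{\mathrm{Tow}(n-1)}$ for $n\geq 2$. *)

(* Defs.v *)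
From mathcomp Require Import all_boot.

Set Implicit Arguments.
Unset Strict Implicit.
Unset Printing Implicit Defensive.

(* Only the values of [c] on {1, ..., N} matter: x, d >= 1 and x + 2d <= N put
   all four points in that range, and for r >= 1 every colouring of
   {1, ..., N} extends to [nat]. *)
Definition every_colouring_has_brauer (r N : nat) : Prop :=
  forall c : nat -> 'I_r,
    exists x d : nat,
      [/\ 0 < x, 0 < d, x + 2 * d <= N
        & [/\ c d = c x, c (x + d) = c x & c (x + 2 * d) = c x]].

(* A relation rather than a function, so that the existence of the Brauer
   number has to be proved and no junk value is involved. *)
Definition is_brauer_number (r B : nat) : Prop :=
  [/\ 0 < B, every_colouring_has_brauer r B
    & forall N, 0 < N -> every_colouring_has_brauer r N -> B <= N].

(* Tow 0 = 1 is a convention extending the recursion; Tow 1 = 2. *)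
Fixpoint Tow (n : nat) : nat :=
  if n is n'.+1 then 2 ^ Tow n' else 1.

(* Main.v *)
Require Import Defs.
From mathcomp Require Import all_boot all_order all_algebra all_field.
From mathcomp Require Import all_classical all_reals all_analysis.
From mathcomp Require Import zify ring lra.

Import Order.TTheory GRing.Theory Num.Theory.
Import numFieldNormedType.Exports.

Set Implicit Arguments.
Unset Strict Implicit.
Unset Printing Implicit Defensive.

(** Colours are eliminated from homogeneous progressions [D, 2D, ..., MD].  If a
    colour has density above 3/4 in [{1, ..., N}], then every [d <= N/16] is the
    difference of a progression of that colour, so that either there is a Brauer
    configuration or the colour is absent from [{1, ..., N/16}].  Otherwise two
    colours [i], [i'] have density at least [1/(4r)].  Intersecting [2M] translates
    of dilates of the two classes gives a set of density [(8r)^(-2M)] in which any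
    3-term progression, of difference [D] say, provides progressions of difference
    [mD] in both classes for all [m <= M]; so both colours are absent from
    [D, 2D, ..., MD].  Roth's theorem, in the form that density [1/K] forces a
    progression once the length is [exp (K^(O(log K)))], makes this step cost two
    exponentials in [M].  Hence each colour costs one exponential, and the height of
    the tower is [r + O(log r)].

    For Roth's theorem the increment is that of Heath-Brown and Szemeredi: a
    progression-free set has Fourier energy comparable to that of its mean on its
    large spectrum, and a progression along which all characters of the spectrum are
    almost constant (found by the pigeonhole principle) then carries a density larger
    by a constant factor. *)

(** * Exponential sums *)

Local Open Scope ring_scope.

(* The modulus with values in the ordered field [algR], where [lra] applies. *)
Definition abs (u : algC) : algR := in_algR (normr_real u).

Lemma abs_ge0 u : 0 <= abs u.
Proof. exact: (normr_ge0 u). Qed.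

Lemma absM u v : abs (u * v) = abs u * abs v.
Proof. by apply: val_inj; rewrite /= normrM. Qed.

Lemma absD u v : abs (u + v) <= abs u + abs v.
Proof. exact: (ler_normD u v). Qed.

Lemma absJ u : abs u^* = abs u.
Proof. by apply: val_inj; rewrite /= norm_conjC. Qed.

Lemma abs_nat n : abs n%:R = n%:R.
Proof. by apply: val_inj; rewrite /= normr_nat rmorph_nat. Qed.

Lemma abs_sum (I : finType) (P : pred I) (F : I -> algC) :
  abs (\sum_(i | P i) F i) <= \sum_(i | P i) abs (F i).
Proof.
elim/big_ind2: _ => [|u a v b ua vb|i _]; rewrite ?lexx //.
  by rewrite (abs_nat 0).
exact: le_trans (absD _ _) (lerD ua vb).
Qed.

Lemma abs_sqr u : algRval (abs u ^+ 2) = u * u^*.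
Proof. by rewrite rmorphXn /= normCK. Qed.

Lemma abs_le u a : (abs u <= a) = (`|u| <= algRval a).
Proof. by []. Qed.

Section ExpSum.
Variables (N : nat) (z : algC).
Hypothesis zN : N.-primitive_root z.

(** An arbitrary map [a] on a finite type lets sums over pairs [x + j * q] and over doubles [2 * y]
    obey the same identities. *)
Definition expsum (I : finType) (P : pred I) (a : I -> nat) (t : nat) : algC :=
  \sum_(i | P i) z ^+ (t * a i).

Lemma prim_root_norm1 : `|z| = 1.
Proof.
have N0 := prim_order_gt0 zN.
apply/eqP; rewrite -(pexpr_eq1 N0) ?normr_ge0 //.
by rewrite -normrX (prim_expr_order zN) normr1.
Qed.

Lemma abs_prim_rootX k : abs (z ^+ k) = 1.
Proof. by apply: val_inj; rewrite /= normrX prim_root_norm1 expr1n. Qed.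

(** Orthogonality of characters: the terms are powers of the [N]-th root of unity [z ^+ a / z ^+ b],
    whose geometric sum vanishes unless the root is 1. *)
Lemma sum_prim_root_pairing a b :
  \sum_(t < N) z ^+ (t * a) * (z ^+ (t * b))^* = (N * (a == b %[mod N]))%:R.
Proof.
have N0 := prim_order_gt0 zN.
have z0 k : z ^+ k != 0.
  by rewrite -normr_eq0 normrX prim_root_norm1 expr1n oner_eq0.
have conjz k : (z ^+ k)^* = (z ^+ k)^-1.
  by rewrite invC_norm normrX prim_root_norm1 expr1n expr1n invr1 mul1r.
pose w := z ^+ a / z ^+ b.
have wE t : z ^+ (t * a) * (z ^+ (t * b))^* = w ^+ t.
  by rewrite conjz expr_div_n -!exprM ![(_ * t)%N]mulnC.
rewrite (eq_bigr (fun t : 'I_N => w ^+ t)) => [|t _]; last exact: wE.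
have w1 : (w == 1) = (a == b %[mod N]).
  by rewrite -(eq_prim_root_expr zN) -(inj_eq (mulIf (z0 b))) divfK // mul1r.
case: eqP w1 => [-> <-|/eqP nw1 <-].
  under eq_bigr do rewrite expr1n.
  by rewrite sumr_const card_ord muln1.
have wN : w ^+ N = 1.
  rewrite expr_div_n -!exprM ![(_ * N)%N]mulnC !exprM (prim_expr_order zN).
  by rewrite !expr1n divr1.
have geom n : (0 < n)%N -> w ^+ n = 1 -> \sum_(t < n) w ^+ t = 0.
  by case: n => // n _ /eqP; rewrite expfS_eq1 (negPf nw1) => /eqP.
by rewrite geom // muln0.
Qed.

Lemma expsum_pairing (I J : finType) (P : pred I) (Q : pred J) a b :
  \sum_(t < N) expsum P a t * (expsum Q b t)^* =
  (N * \sum_(i | P i) \sum_(j | Q j) (a i == b j %[mod N]))%:R.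
Proof.
rewrite (eq_bigr (fun t : 'I_N => \sum_(i | P i) \sum_(j | Q j)
  z ^+ (t * a i) * (z ^+ (t * b j))^*)); last first.
  by move=> t _; rewrite /expsum rmorph_sum big_distrlr.
rewrite exchange_big /= big_distrr natr_sum; apply: eq_bigr => i _.
rewrite exchange_big /= big_distrr natr_sum; apply: eq_bigr => j _.
exact: sum_prim_root_pairing.
Qed.

Lemma expsumM (I J : finType) (P : pred I) (Q : pred J) a b t :
  expsum P a t * expsum Q b t =
  expsum [pred p : I * J | P p.1 && Q p.2] (fun p => a p.1 + b p.2)%N t.
Proof.
rewrite /expsum big_distrlr /= pair_big; apply: eq_bigr => p _.
by rewrite -exprD mulnDr.
Qed.

Lemma abs_expsum (I : finType) (P : pred I) a t :
  abs (expsum P a t) <= (\sum_(i | P i) 1%N)%:R.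
Proof.
apply: le_trans (abs_sum _ _) _.
by rewrite natr_sum ler_sum // => i _; rewrite abs_prim_rootX.
Qed.

Lemma sum_abs_expsum_sqr (I : finType) (P : pred I) a :
  \sum_(t < N) abs (expsum P a t) ^+ 2 =
  (N * \sum_(i | P i) \sum_(j | P j) (a i == a j %[mod N]))%:R.
Proof.
apply: val_inj; rewrite [LHS](rmorph_sum algRval) [RHS](rmorph_nat algRval).
by rewrite -expsum_pairing; apply: eq_bigr => t _; exact: abs_sqr.
Qed.

End ExpSum.

(* Pigeonhole on a grid of mesh [1/g] for the real and imaginary parts; no
   estimate on the argument of a root of unity is needed. *)
Lemma prim_root_recurrence (N : nat) (z : algC) (s : seq nat) (g Q : nat) :
  N.-primitive_root z -> (0 < g)%N ->
  Q = (((2 * g).+1 ^ 2) ^ size s)%N ->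
  exists q, [/\ (0 < q)%N, (q <= Q)%N &
    forall t, t \in s -> abs (z ^+ (t * q) - 1) <= 2%:R / g%:R].
Proof.
move=> zN g0 sQ.
have nz k : `|z ^+ k| = 1 by rewrite normrX (prim_root_norm1 zN) expr1n.
pose cell (u : algC) : nat := Num.trunc ((u + 1) * g%:R).
have cellP u : u \is Num.real -> `|u| <= 1 ->
    (cell u)%:R <= (u + 1) * g%:R < (cell u).+1%:R /\ (cell u < (2 * g).+1)%N.
  move=> ur; rewrite real_ler_norml // => /andP [u1 u2].
  have p0 : 0 <= (u + 1) * g%:R.
    by rewrite mulr_ge0 ?ler0n // -(opprK 1) subr_ge0.
  split; first exact: truncn_itv.
  rewrite truncn_lt_nat //.
  apply: (@le_lt_trans _ _ ((2 * g)%:R)); last by rewrite ltr_nat.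
  by rewrite natrM ler_wpM2r ?ler0n // -[2%:R]/(1 + 1) lerD2r.
have cell_close u v : u \is Num.real -> v \is Num.real -> `|u| <= 1 ->
    `|v| <= 1 -> cell u = cell v -> `|u - v| <= g%:R^-1.
  move=> ur vr /(cellP _ ur) [/andP [u1 u2] _] /(cellP _ vr) [/andP [v1 v2] _].
  move=> uv; rewrite uv in u1 u2.
  have gR0 : 0 < g%:R :> algC by rewrite ltr0n.
  rewrite -(ler_pM2r gR0) mulVf ?gt_eqF // -(ger0_norm (ltW gR0)) -normrM.
  rewrite (_ : (u - v) * g%:R = (u + 1) * g%:R - (v + 1) * g%:R); last by ring.
  have hr w : w \is Num.real -> (w + 1) * g%:R \is Num.real.
    by move=> wr; rewrite rpredM ?rpredD ?realn ?real1.
  rewrite real_ler_norml ?rpredB ?hr //; apply/andP; split.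
    rewrite lerBrDr addrC lerBlDr; apply: le_trans (ltW v2) _.
    by rewrite -natr1 lerD2r.
  rewrite lerBlDr; apply: le_trans (ltW u2) _.
  by rewrite -natr1 addrC lerD2l.
(* Each frequency in [s] has $(2g+1)^2$ cells, which makes [Q] patterns. Two of the [Q.+1] exponents
   share one, and their difference serves as [q]. *)
pose f (x : 'I_Q.+1) : {ffun 'I_(size s) -> ('I_(2 * g).+1 * 'I_(2 * g).+1)%type} :=
  [ffun i : 'I_(size s) => (inord (cell ('Re (z ^+ (nth 0%N s i * x)))),
              inord (cell ('Im (z ^+ (nth 0%N s i * x)))))].
have [x [y [ltxy fxy]]] : exists x y : 'I_Q.+1, (x < y)%N /\ f x = f y.
  have /injectivePn [x [y nxy fxy]] : ~~ injectiveb f.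
    apply/negP => /injectiveP /leq_card; apply/negP; rewrite -ltnNge.
    by rewrite card_ord card_ffun card_prod !card_ord mulnn -sQ.
  case: (ltngtP x y) => h; first by exists x, y.
    by exists y, x.
  by move/val_inj: h nxy => ->; rewrite eqxx.
exists (y - x)%N; split; first by rewrite subn_gt0.
  by apply: leq_trans (leq_subr _ _) _; rewrite -ltnS.
move=> t /(nthP 0%N) [i si <-] {t}; set t := nth _ _ _.
have e1 : z ^+ (t * (y - x)) - 1 =
    (z ^+ (t * y) - z ^+ (t * x)) * (z ^+ (t * x))^-1.
  have zx : z ^+ (t * x) != 0 by rewrite -normr_eq0 nz oner_eq0.
  rewrite mulrBl divff //; congr (_ - _).
  by apply: (mulIf zx); rewrite divfK // -exprD -mulnDr subnK // ltnW.
have -> : abs (z ^+ (t * (y - x)) - 1) = abs (z ^+ (t * y) - z ^+ (t * x)).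
  by apply: val_inj; rewrite /= e1 normrM normfV nz invr1 mulr1.
have /ffunP /(_ (Ordinal si)) := fxy; rewrite !ffunE /= -/t.
set u := z ^+ (t * x); set v := z ^+ (t * y).
have bnd (w : algC) : `|w| = 1 -> `|'Re w| <= 1 /\ `|'Im w| <= 1.
  move=> w1; split; rewrite -[leRHS]w1.
    by rewrite (leif_normC_Re_Creal w).
  rewrite -(ler_pXn2r (n := 2)) ?nnegrE ?normr_ge0 // (normC2_Re_Im w).
  by rewrite real_normK ?Creal_Im // lerDr real_exprn_even_ge0 ?Creal_Re.
move=> [/(congr1 val) /= hR /(congr1 val) /= hI].
have [uR uI] := bnd u (nz _); have [vR vI] := bnd v (nz _).
have cellK w : w \is Num.real -> `|w| <= 1 ->
    nat_of_ord (inord (cell w) : 'I_(2 * g).+1) = cell w.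
  by move=> wr w1; rewrite inordK // (proj2 (cellP w wr w1)).
rewrite !cellK ?Creal_Re ?Creal_Im // in hR hI.
rewrite abs_le rmorphM fmorphV !rmorph_nat /=.
have -> : v - u = 'Re (v - u) + 'i * 'Im (v - u) by rewrite -Crect.
apply: le_trans (ler_normD _ _) _; rewrite normrM normCi mul1r.
rewrite -[2%:R]/(1 + 1) mulrDl mul1r !raddfB.
by apply: lerD; apply: cell_close; rewrite /= ?Creal_Re ?Creal_Im.
Qed.

Local Close Scope ring_scope.

(** * Additive energy and progressions *)

Definition cnt (B : pred nat) (n : nat) : nat := \sum_(x < n) B x.

Definition ap3_free (B : pred nat) (n : nat) : Prop :=
  forall x d, 0 < d -> x + 2 * d < n -> ~~ [&& B x, B (x + d) & B (x + 2 * d)].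

(* The set seen along [y, y - q, y - 2q, ...]; running backwards keeps all the
   indices natural. *)
Definition back_ap (B : pred nat) (q y : nat) : pred nat :=
  fun j => (j * q <= y) && B (y - j * q).

Lemma sum_eq_le (N : nat) (F : pred nat) c : \sum_(x < N) (F x && (x == c :> nat)) <= F c.
Proof.
have [cN|cN] := ltnP c N; last first.
  rewrite big1 // => x _; case: eqP => [xc|]; last by rewrite andbF.
  by have := ltn_ord x; rewrite xc ltnNge cN.
rewrite (bigD1 (Ordinal cN)) //= eqxx andbT big1 ?addn0 // => x.
by rewrite -val_eqE /= => /negPf ->; rewrite andbF.
Qed.

Lemma eqmod_lt2 N u v : u < 2 * N -> v < 2 * N ->
  (u == v %[mod N]) <= (u == v) + (u == v + N) + (v == u + N).
Proof.
move=> uN vN; case: eqP => // uv.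
have [e|ne] := eqVneq u v; first by [].
have [e|ne2] := eqVneq u (v + N); first by lia.
have [e|ne3] := eqVneq v (u + N); first by lia.
suff : False by [].
have hd w : w < 2 * N -> w %% N = w \/ w %% N + N = w.
  move=> wN; have [lt|ge] := ltnP w N; first by left; rewrite modn_small.
  by right; rewrite -{1}(subnK ge) modnDr modn_small ?subnK //; lia.
by case: (hd u uN) (hd v vN) => hu []; lia.
Qed.

Section Energy.
Variables (N l q : nat).

(* [N] times this is the sum of |X^(t)|^2 |P^(t)|^2, where [P] is a progression of
   step [q] and length [l]. *)
Definition energy (X : pred nat) : nat :=
  \sum_(p : 'I_N * 'I_l | X p.1) \sum_(p' : 'I_N * 'I_l | X p'.1)
    (p.1 + p.2 * q == p'.1 + p'.2 * q %[mod N]).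

(** As [p.1 < N], the equality forces [p'.1 < l * q]; then [p'] and [p.2] determine [p.1]. *)
Lemma wrapped_energy_le (X : pred nat) :
  \sum_(p : 'I_N * 'I_l | X p.1) \sum_(p' : 'I_N * 'I_l | X p'.1)
    (p.1 + p.2 * q == p'.1 + p'.2 * q + N) <= l * l * (l * q).
Proof.
apply: leq_trans (_ : \sum_(p : 'I_N * 'I_l) \sum_(p' : 'I_N * 'I_l)
    (p.1 + p.2 * q == p'.1 + p'.2 * q + N) <= _).
  rewrite big_mkcond leq_sum // => p _; case: ifP => // _.
  by rewrite big_mkcond leq_sum // => p' _; case: ifP.
rewrite exchange_big /=.
apply: leq_trans (_ : \sum_(p' : 'I_N * 'I_l) \sum_(j < l) (p'.1 < l * q) <= _).
  apply: leq_sum => -[x' j'] _ /=.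
  rewrite -(pair_bigA _ (fun (x : 'I_N) (j : 'I_l) =>
    (x + j * q == x' + j' * q + N) : nat)) exchange_big leq_sum // => j _ /=.
  have [lt|ge] := ltnP x' (l * q); last first.
    rewrite big1 // => x _; case: eqP => // e; have := ltn_ord x.
    have : j * q <= l * q by rewrite leq_mul2r ltnW ?orbT.
    by lia.
  apply: leq_trans (@sum_eq_le N predT (x' + j' * q + N - j * q)).
  by apply: leq_sum => x _ /=; case: eqP => // e; case: eqP => //; lia.
rewrite -(pair_bigA _ (fun (x : 'I_N) (j' : 'I_l) => \sum_(j < l) ((x < l * q)%N : nat))) /=.
under eq_bigr do rewrite !sum_nat_const !card_ord mulnA.
rewrite -big_distrr /= leq_mul2l.
have -> : \sum_(i < N) (i < l * q) <= l * q; last by rewrite orbT.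
have gen n c : \sum_(i < n) (i < c) <= c.
  elim: n => [|n IH]; first by rewrite big_ord0.
  rewrite big_ord_recr /=; have [lt|ge] := ltnP n c; last by rewrite addn0.
  rewrite addn1; suff h : \sum_(i < n) (i < c) <= n by apply: leq_ltn_trans h lt.
  rewrite -[n in _ <= n]card_ord -sum1_card.
  by apply: leq_sum => i _; apply: leq_b1.
exact: gen.
Qed.

(** Without wrapping, the pairs [p'] matched to [p] are points of [X] on the backward progression
    from [p.1 + p.2 * q], at most [m] in number. The two directions of wrapping are error terms. *)
Lemma energy_le (X : pred nat) m : l * q <= N ->
  (forall y, cnt (back_ap X q y) l <= m) ->
  energy X <= cnt X N * l * m + 2 * (l * l * (l * q)).
Proof.
move=> lqN hm.
have lt2 (p : 'I_N * 'I_l) : p.1 + p.2 * q < 2 * N.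
  have := ltn_ord p.1; have : p.2 * q <= l * q by rewrite leq_mul2r ltnW ?orbT.
  by lia.
apply: leq_trans (_ : \sum_(p : 'I_N * 'I_l | X p.1)
    \sum_(p' : 'I_N * 'I_l | X p'.1)
    ((p.1 + p.2 * q == p'.1 + p'.2 * q) + (p.1 + p.2 * q == p'.1 + p'.2 * q + N)
      + (p'.1 + p'.2 * q == p.1 + p.2 * q + N)) <= _).
  by apply: leq_sum => p _; apply: leq_sum => p' _; apply: eqmod_lt2.
under eq_bigr do rewrite !big_split /=.
rewrite !big_split /=.
rewrite [X in _ + _ + X <= _]exchange_big /= mul2n -addnn addnA.
rewrite !leq_add ?wrapped_energy_le //.
apply: leq_trans (_ : \sum_(p : 'I_N * 'I_l | X p.1) m <= _).
  apply: leq_sum => p _; apply: leq_trans (hm (p.1 + p.2 * q)).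
  rewrite big_mkcond /= -(pair_bigA _ (fun (x : 'I_N) (j : 'I_l) =>
     if X x then (p.1 + p.2 * q == x + j * q : nat) else 0)) exchange_big /=.
  apply: leq_sum => j _; rewrite /back_ap; set y := p.1 + _.
  have [le|gt] := leqP (j * q) y; last first.
    by rewrite big1 //= => x _; case: ifP => // _; case: eqP => //; lia.
  rewrite (eq_bigr (fun x : 'I_N => (X x && (x == y - j * q :> nat)) : nat)).
    exact: sum_eq_le.
  move=> x _; case: ifP => //= _; congr (nat_of_bool _); apply/eqP/eqP; lia.
rewrite big_mkcond /= -(pair_bigA _ (fun (x : 'I_N) (j : 'I_l) =>
     if X x then m else 0)) /=.
under eq_bigr do rewrite sum_nat_const card_ord.
rewrite /cnt !big_distrl leq_sum // => x _ /=.
by case: ifP => // _; rewrite ?mul1n ?muln0.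
Qed.

End Energy.

Local Open Scope ring_scope.

(** * Fourier count of 3-term progressions *)

Section Counting.
Variables (N : nat) (z : algC).
Hypothesis zN : N.-primitive_root z.

Definition fsum (X : pred nat) (t : nat) : algC :=
  expsum z (fun x : 'I_N => X x) (fun x => x : nat) t.

Lemma fsum0 X : fsum X 0 = (cnt X N)%:R.
Proof.
rewrite /fsum /expsum /cnt natr_sum big_mkcond; apply: eq_bigr => x _ /=.
by rewrite mul0n expr0; case: (X x).
Qed.

Lemma abs_fsum X t : abs (fsum X t) <= (cnt X N)%:R.
Proof.
apply: le_trans (abs_expsum zN _ _ _) _.
by rewrite /cnt big_mkcond ler_nat leq_sum // => x _; case: (X x).
Qed.

Lemma sum_abs_fsum_sqr X : \sum_(t < N) abs (fsum X t) ^+ 2 = (N * cnt X N)%:R.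
Proof.
rewrite (sum_abs_expsum_sqr zN); congr (_ * _)%:R.
rewrite /cnt big_mkcond; apply: eq_bigr => x _; case: (boolP (X x)) => // Xx.
rewrite (bigD1 x) //= eqxx big1 // => y /andP [_ /negPf yx].
by rewrite !modn_small ?ltn_ord // val_eqE eq_sym yx.
Qed.

Lemma sum_abs_fsum_energy X l q :
  \sum_(t < N) abs (fsum X t) ^+ 2 *
    abs (\sum_(j < l) z ^+ (t * (j * q))) ^+ 2 = (N * energy N l q X)%:R.
Proof.
pose P : 'I_l -> bool := xpredT.
rewrite (eq_bigr (fun t : 'I_N => abs (expsum z
  [pred p : 'I_N * 'I_l | X p.1 && P p.2] (fun p => p.1 + p.2 * q)%N t) ^+ 2)).
  rewrite (sum_abs_expsum_sqr zN); congr (_ * _)%:R; rewrite /energy.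
  rewrite (eq_bigl (fun p : 'I_N * 'I_l => X p.1)) => [|p]; last exact: andbT.
  apply: eq_bigr => p _.
  by rewrite (eq_bigl (fun p : 'I_N * 'I_l => X p.1)) => [|p']; last exact: andbT.
move=> t _; rewrite -exprMn -absM.
by rewrite -(expsumM z (fun x : 'I_N => X x) P (fun x => x : nat) (fun j => j * q)%N).
Qed.

(* With [x] and [y] in the middle third, [2y - x] lies in [[0, N)], so that the
   congruence [x + w = 2y] modulo [N] is an equality. *)
Lemma sum_fsum_ap3 (B : pred nat) n : N = (3 * n)%N -> ap3_free B N ->
  let B1 : pred nat := fun x => B x && (n <= x < 2 * n)%N in
  \sum_(t < N) fsum B1 t * fsum B t * (fsum B1 (2 * t))^* = (N * cnt B1 N)%:R.
Proof.
move=> Nn free B1.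
rewrite (eq_bigr (fun t : 'I_N => expsum z
    [pred p : 'I_N * 'I_N | B1 p.1 && B p.2] (fun p => p.1 + p.2)%N t *
   (expsum z (fun y : 'I_N => B1 y) (fun y => 2 * y)%N t)^*)).
  rewrite (expsum_pairing zN); congr (_ * _)%:R.
  rewrite exchange_big /cnt big_mkcond /=; apply: eq_bigr => y _.
  case: (boolP (B1 y)) => // B1y.
  have By : B y by case/andP: B1y.
  rewrite (bigD1 (y, y)) /=; last by rewrite B1y By.
  rewrite addnn mul2n eqxx big1 // => -[x w] /= /andP [/andP [B1x Bw] nxy].
  case: eqP => // e; case/negP: nxy.
  have [Bx hx] := andP B1x; have [_ hy] := andP B1y.
  have wx : (x + w = 2 * y)%N.
    have hw := ltn_ord w.
    have := @eqmod_lt2 N (x + w)%N (2 * y)%N.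
    by rewrite e !mul2n eqxx; lia.
  have [xy|yx|xy] := ltngtP x y.
  - have := free x (y - x)%N; rewrite subn_gt0 xy.
    rewrite (_ : x + (y - x) = y)%N; last by lia.
    rewrite (_ : x + 2 * (y - x) = w)%N; last by lia.
    by rewrite Bx By Bw ltn_ord => /(_ isT isT).
  - have := free w (x - y)%N; rewrite subn_gt0 yx.
    rewrite (_ : w + (x - y) = y)%N; last by lia.
    rewrite (_ : w + 2 * (x - y) = x)%N; last by lia.
    by rewrite Bx By Bw ltn_ord => /(_ isT isT).
  - have wy : (w = y :> nat)%N by lia.
    by rewrite (val_inj xy) (val_inj wy).
move=> t _; rewrite -(expsumM z (fun x : 'I_N => B1 x) (fun x : 'I_N => B x)
  (fun x => x : nat) (fun x => x : nat)).
congr (_ * _^*); rewrite /fsum /expsum; apply: eq_bigr => y _.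
by rewrite mulnAC mulnC.
Qed.

End Counting.

Local Close Scope ring_scope.

(** Backward progressions of step 1 are intervals, and [c] of them tile the given one. *)
Lemma cnt_interval_le (B : pred nat) l m a c :
  (forall y, cnt (back_ap B 1 y) l <= m) -> \sum_(x < c * l) B (a + x) <= c * m.
Proof.
move=> hm; elim: c => [|c IH]; first by rewrite mul0n big_ord0.
rewrite mulSn addnC big_split_ord /= mulSn addnC leq_add //.
apply: leq_trans (hm (a + c * l + l).-1); rewrite /cnt (reindex_inj rev_ord_inj) /=.
apply: leq_sum => j _; rewrite /back_ap muln1.
have jl := ltn_ord j.
rewrite (_ : j <= (a + c * l + l).-1) /=; last by lia.
by rewrite (_ : a + (c * l + (l - j.+1)) = (a + c * l + l).-1 - j) //; lia.
Qed.

Lemma cnt_thirds (B : pred nat) n :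
  let B1 : pred nat := fun x => B x && (n <= x < 2 * n)%N in
  cnt B (3 * n) = \sum_(x < n) B (0 + x) + cnt B1 (3 * n)
                  + \sum_(x < n) B (2 * n + x).
Proof.
move=> B1.
have e3 : 3 * n = n + n + n by lia.
have part (X : pred nat) : cnt X (3 * n) =
    \sum_(x < n) X (0 + x) + \sum_(x < n) X (n + x) + \sum_(x < n) X (2 * n + x).
  by rewrite /cnt e3 !big_split_ord /= !mul2n -!addnn.
rewrite !part; congr (_ + _ + _); rewrite [X in _ = X + _ + _]big1; last first.
  by move=> x _; rewrite /B1; have := ltn_ord x; case: leqP; rewrite ?andbF //; lia.
rewrite [X in _ = _ + _ + X]big1 ?addn0 ?add0n; last first.
  move=> x _; rewrite /B1 (_ : (2 * n + x < 2 * n) = false) ?andbF //.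
  by apply/negbTE; rewrite -leqNgt leq_addr.
apply: eq_bigr => x _; rewrite /B1; have := ltn_ord x => xn.
by rewrite leq_addr mul2n -addnn ltn_add2l xn !andbT.
Qed.

Local Open Scope ring_scope.

Lemma abs_expr_sub1 (w : algC) j : abs w = 1 -> abs (w ^+ j - 1) <= j%:R * abs (w - 1).
Proof.
move=> w1; elim: j => [|j IH].
  by rewrite expr0 subrr mul0r (abs_nat 0).
have -> : w ^+ j.+1 - 1 = w * (w ^+ j - 1) + (w - 1) by rewrite exprS; ring.
apply: le_trans (absD _ _) _; rewrite absM w1 mul1r -natr1 mulrDl mul1r.
exact: lerD.
Qed.

(** * The large spectrum of a progression-free set *)

Section LargeSpectrum.
Variables (N : nat) (z : algC).
Hypothesis zN : N.-primitive_root z.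
Let N0 : (0 < N)%N := prim_order_gt0 zN.

(** Frequency 0 is left out because it carries the main term of the count. *)
Definition spectrum (B : pred nat) (tau : algR) : {set 'I_N} :=
  [set t : 'I_N | (t != 0%N :> nat) && (tau <= abs (fsum N z B t))].

Lemma card_spectrum B tau : 0 <= tau ->
  (#|spectrum B tau|)%:R * tau ^+ 2 <= (N * cnt B N)%:R.
Proof.
move=> t0; rewrite -(sum_abs_fsum_sqr zN) mulr_natl -sumr_const.
rewrite [leRHS](bigID (fun t => t \in spectrum B tau)) /=.
rewrite -[leLHS]addr0 lerD //; last by apply: sumr_ge0 => t _; apply: sqr_ge0.
apply: ler_sum => t; rewrite inE => /andP [_ h].
by rewrite ler_pXn2r ?nnegrE ?abs_ge0.
Qed.

(** For odd [N] doubling is injective modulo [N], so Parseval's identity survives the replacement of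
    [t] by [2 * t]. *)
Lemma sum_abs_fsum_double X : odd N ->
  \sum_(t < N) abs (fsum N z X (2 * t)) ^+ 2 = (N * cnt X N)%:R.
Proof.
move=> oN.
rewrite (eq_bigr (fun t : 'I_N => abs (expsum z (fun y : 'I_N => X y)
  (fun y => 2 * y)%N t) ^+ 2)); last first.
  move=> t _; congr (abs _ ^+ 2); rewrite /fsum /expsum; apply: eq_bigr => y _.
  by rewrite mulnAC mulnC.
rewrite (sum_abs_expsum_sqr zN); congr (_ * _)%:R.
rewrite /cnt big_mkcond; apply: eq_bigr => x _; case: (boolP (X x)) => // Xx.
rewrite (bigD1 x) //= eqxx big1 // => y /andP [_].
rewrite -val_eqE /= => yx; case: eqP => // e; case/negP: yx.
have := @eqmod_lt2 N (2 * x) (2 * y); rewrite e eqxx.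
have := ltn_ord x; have := ltn_ord y; have := odd_double_half N.
by rewrite oN; lia.
Qed.

(** Only trivial progressions are counted, at most half of the main term $b_1^2b$, so the nonzero
    frequencies must cancel the rest. Those below the threshold contribute at most a quarter; on the
    spectrum the third factor is at most $b_1$. *)
Lemma sum_spectrum_ge (B : pred nat) n : N = (3 * n)%N -> odd N -> ap3_free B N ->
  let B1 : pred nat := fun x => B x && (n <= x < 2 * n)%N in
  let b1 := (cnt B1 N)%:R in let b := (cnt B N)%:R in
  0 < b1 -> 2%:R * N%:R <= b1 * b ->
  b1 * b / 4%:R <=
    \sum_(t in spectrum B (b1 * b / (4%:R * N%:R)))
      abs (fsum N z B1 t) * abs (fsum N z B t).
Proof.
move=> Nn oN free B1 b1 b b1_gt0 Nb.
set tau := b1 * b / (4%:R * N%:R).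
have NR : 0 < N%:R :> algR by rewrite ltr0n.
have bge0 : 0 <= b by apply: ler0n.
have tau0 : 0 <= tau by rewrite /tau divr_ge0 ?mulr_ge0 ?ler0n // ltW.
set S := \sum_(t in _) _.
pose F (t : 'I_N) := fsum N z B1 t * fsum N z B t * (fsum N z B1 (2 * t))^*.
have : \sum_(t < N) F t = (N * cnt B1 N)%:R by exact: sum_fsum_ap3.
rewrite (bigD1 (Ordinal N0)) //= {1}/F /= muln0 !fsum0 => e.
have e2 : abs (\sum_(t < N | t != Ordinal N0) F t) >= b1 * b * b1 - N%:R * b1.
  have -> : \sum_(t < N | t != Ordinal N0) F t =
     (N * cnt B1 N)%:R + - (cnt B1 N * cnt B N * cnt B1 N)%:R.
    rewrite -e !natrM conjC_nat addrAC subrr add0r.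
    by apply: eq_bigr.
  have := absD ((N * cnt B1 N)%:R + - (cnt B1 N * cnt B N * cnt B1 N)%:R)
     (- (N * cnt B1 N)%:R).
  have absN u : abs (- u) = abs u by apply: val_inj; rewrite /= normrN.
  rewrite addrAC subrr add0r !absN !abs_nat !natrM -/b1 -/b.
  by move=> h; rewrite lerBlDr.
have e3 : \sum_(t < N | t != Ordinal N0) abs (F t) <= b1 * S + tau * (N%:R * b1).
  rewrite (bigID (fun t => t \in spectrum B tau)) /=; apply: lerD.
    rewrite /S big_distrr /= [leRHS]big_mkcond /= big_mkcond; apply: ler_sum => t _.
    case: (t \in _); rewrite ?andbF //.
    case: (_ != _) => /=; last by rewrite !mulr_ge0 ?abs_ge0 // ltW.
    rewrite /F !absM absJ [leRHS]mulrC ler_wpM2l ?mulr_ge0 ?abs_ge0 //.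
    exact: abs_fsum.
  (* Parseval at [t] and at [2 * t], in the form suited to $yw\le(y^2+w^2)/2$. *)
  have -> : N%:R * b1 = \sum_(t < N) (abs (fsum N z B1 t) ^+ 2 +
       abs (fsum N z B1 (2 * t)) ^+ 2) / 2%:R.
    rewrite -big_distrl /= big_split /= sum_abs_fsum_double //.
    rewrite (sum_abs_fsum_sqr zN) natrM -/b1; lra.
  rewrite big_distrr /= big_mkcond; apply: ler_sum => t _.
  case: ifP => [/andP [t0 nt]|_]; last first.
    by rewrite mulr_ge0 // divr_ge0 ?ler0n // addr_ge0 ?sqr_ge0.
  rewrite /F !absM absJ.
  have hb : abs (fsum N z B t) <= tau.
    by move: nt; rewrite inE -val_eqE /= in t0 *; rewrite t0 /= -ltNge => /ltW.
  have := abs_ge0 (fsum N z B1 t); have := abs_ge0 (fsum N z B1 (2 * t)).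
  have := abs_ge0 (fsum N z B t); move: hb.
  set x := abs _; set w := abs _; set y := abs _ => hx x0 w0 y0.
  apply: le_trans (_ : tau * (y * w) <= _).
    by rewrite [y * x]mulrC -mulrA ler_wpM2r // mulr_ge0.
  rewrite ler_wpM2l //; have := sqr_ge0 (y - w); lra.
have e4 := le_trans e2 (le_trans (abs_sum _ _) e3).
have e5 : tau * (N%:R * b1) = b1 * (b1 * b / 4%:R).
  by rewrite /tau; field; rewrite gt_eqF.
rewrite e5 in e4.
have : b1 * (b1 * b - N%:R) <= b1 * (S + b1 * b / 4%:R) by lra.
by rewrite ler_pM2l //; lra.
Qed.

End LargeSpectrum.

Local Close Scope ring_scope.

(** * Roth's theorem *)

(** Each of the [l] terms differs from 1 by at most $l\cdot 2/(20l)=1/10$. *)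
Lemma abs_progression_sum_ge (N : nat) (z : algC) t q l : (N.-primitive_root z)%R ->
  (abs (z ^+ (t * q) - 1) <= 2%:R / (20 * l)%N%:R)%R ->
  (9%:R / 10%:R * l%:R <= abs (\sum_(j < l) z ^+ (t * (j * q))))%R.
Proof.
move=> zN hq; set P := (\sum_(j < l) _)%R.
have [->|l0] := posnP l; first by rewrite mulr0 abs_ge0.
have lR : (0 < l%:R :> algR)%R by rewrite ltr0n.
have h : (abs (\sum_(j < l) (1 - z ^+ (t * (j * q)))) <= l%:R / 10%:R)%R.
  apply: le_trans (abs_sum _ _) _.
  apply: le_trans (_ : \sum_(j < l) (10%:R^-1 : algR) <= _)%R; last first.
    by rewrite sumr_const card_ord mulr_natl.
  apply: ler_sum => j _.
  have -> : abs (1 - z ^+ (t * (j * q)))%R = abs ((z ^+ (t * q)) ^+ j - 1)%R.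
    by apply: val_inj; rewrite /= distrC -exprM mulnAC -mulnA.
  apply: le_trans (abs_expr_sub1 _ (abs_prim_rootX zN _)) _.
  apply: le_trans (_ : l%:R * (2%:R / (20 * l)%N%:R) <= _)%R.
    by rewrite ler_pM ?ler0n ?abs_ge0 // ler_nat ltnW.
  rewrite natrM (_ : l%:R * (2%:R / (20%:R * l%:R)) = 10%:R^-1 :> algR)%R //.
  by field; rewrite gt_eqF.
have : (l%:R <= abs P + l%:R / 10%:R :> algR)%R; last by move: (abs P) => a ha; lra.
apply: le_trans (lerD (lexx _) h); rewrite big_split /= sumr_const card_ord.
rewrite sumrN -/P; apply: le_trans (absD _ _).
by rewrite addrCA subrr addr0 abs_nat.
Qed.

(** Each outer third holds at most $(1+1/D)b/3$ points, and $1-\frac23(1+1/D)\ge 3/10$ once $D\ge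
    20$. *)
Lemma middle_third_ge D b b1 o1 o2 x : 200 <= D -> x * (3 * D) <= D.+1 * b ->
  o1 <= x -> o2 <= x -> b = o1 + b1 + o2 -> 3 * b <= 10 * b1.
Proof.
move=> D200 hx h1 h2 e.
have D20 : 20 <= D by apply: leq_trans D200.
have D0 : 0 < D by apply: leq_trans D20.
have h3 : (b - b1) * (3 * D) <= 2 * x * (3 * D) by rewrite leq_mul2r; lia.
have h4 : 20 * b <= D * b by rewrite leq_mul2r D20 orbT.
rewrite -(leq_pmul2l D0); clear -hx h3 h4 e; nia.
Qed.

Lemma dense_mul_ge K N b b1 : 0 < K -> N <= K * b -> 8 * K ^ 2 <= N -> b <= 4 * b1 ->
  2 * N <= b1 * b.
Proof.
move=> K0 Nb KN b41.
have h1 : N * N <= (K * b) * (K * b) by apply: leq_mul.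
have h2 : 8 * K ^ 2 * N <= N * N by rewrite leq_mul2r KN orbT.
have h3 : K ^ 2 * (8 * N) <= K ^ 2 * (b * b) by lia.
rewrite leq_pmul2l ?expn_gt0 ?K0 // in h3.
have h4 : b * b <= 4 * b1 * b by rewrite leq_mul2r b41 orbT.
lia.
Qed.

(** Keeps the wrap-around error in the energy at most $l^2b^2/(DN)$. *)
Lemma dense_wrap_le K N b x : 0 < K -> N <= K * b -> K ^ 2 * x <= N ->
  x * N <= b * b.
Proof.
move=> K0 Nb KN.
have h1 : N * N <= (K * b) * (K * b) by apply: leq_mul.
have h2 : K ^ 2 * x * N <= N * N by rewrite leq_mul2r KN orbT.
have h3 : K ^ 2 * (x * N) <= K ^ 2 * (b * b) by lia.
by rewrite leq_pmul2l ?expn_gt0 ?K0 // in h3.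
Qed.

(** Parseval with threshold $b_1b/(4N)$ gives $S\le 16N^3/(b_1^2b)$; then $b_1\ge b/4$ and $b\ge
    N/K$ are inserted. *)
Lemma spectrum_size_le K N b b1 S : 0 < b -> N <= K * b -> b <= 4 * b1 ->
  S * (b1 * b) ^ 2 <= N * b * (16 * N ^ 2) -> S <= 16 * 16 * K ^ 3.
Proof.
move=> b0 Nb b41 h.
have h2 : S * (b1 ^ 2 * b) <= 16 * N ^ 3.
  have : b * (S * (b1 ^ 2 * b)) <= b * (16 * N ^ 3).
    by move: h; rewrite !expnS !expn0 !muln1; lia.
  by rewrite leq_pmul2l.
have h3 : S * b ^ 3 <= 16 * 16 * N ^ 3.
  have : S * b * b ^ 2 <= S * b * (4 * b1) ^ 2.
    by rewrite leq_mul2l leq_exp2r // b41 orbT.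
  by move: h2; rewrite !expnS !expn0 !muln1; lia.
have h4 : N ^ 3 <= K ^ 3 * b ^ 3 by rewrite -expnMn leq_exp2r.
rewrite -(leq_pmul2r (_ : 0 < b ^ 3)) ?expn_gt0 ?b0 //.
by apply: leq_trans h3 _; rewrite -[leqRHS]mulnA leq_mul2l h4 orbT.
Qed.

Lemma energy_upper D N l q b bx m E : E <= bx * l * m + 2 * (l * l * (l * q)) ->
  m * (D * N) <= D.+1 * b * l -> 2 * D * (l * q) * N <= b * b ->
  D * (N * E) <= l * l * (D.+1 * bx * b + b * b).
Proof.
move=> hE hm hq.
apply: leq_trans (_ : D * (N * (bx * l * m + 2 * (l * l * (l * q)))) <= _).
  by rewrite !leq_mul2l hE !orbT.
have h1 : bx * l * (m * (D * N)) <= bx * l * (D.+1 * b * l) by rewrite leq_mul2l hm orbT.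
have h2 : l * l * (2 * D * (l * q) * N) <= l * l * (b * b) by rewrite leq_mul2l hq orbT.
move: h1 h2; clear; lia.
Qed.

(** Here $u=b_1b$, $v=b^2$, and [S1], [S2], [S12] are the sums over the spectrum of $|\hat B_1|^2$,
    $|\hat B|^2$ and $|\hat B_1\hat B|$. Frequency 0 uses up nearly all the energy of [B], which
    leaves $S_2\le v/80$, too little for Cauchy-Schwarz. *)
Lemma increment_numeric (R : realFieldType) (D u v S1 S2 S12 : R) :
  (200%:R <= D -> 0 < v -> 3%:R * v <= 10%:R * u ->
   D * (4%:R / 5%:R * S1) <= (D + 1) * u + v ->
   D * (v + 4%:R / 5%:R * S2) <= (D + 1) * v + v ->
   u / 4%:R <= S12 -> 2%:R * S12 <= S1 / 5%:R + 5%:R * S2 -> False)%R.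
Proof.
move=> D200 v0 vu h1 h2 h3 h4.
have D0 : (0 < D)%R by lra.
have s1 : (4%:R / 5%:R * S1 <= u + (u + v) / 200%:R)%R.
  rewrite -(ler_pM2l D0); apply: le_trans h1 _.
  have : (200%:R * ((u + v) / 200%:R) <= D * ((u + v) / 200%:R))%R.
    by rewrite ler_wpM2r //; lra.
  lra.
have s2 : (4%:R / 5%:R * S2 <= v / 100%:R)%R.
  rewrite -(ler_pM2l D0).
  have : (200%:R * (v / 100%:R) <= D * (v / 100%:R))%R by rewrite ler_wpM2r //; lra.
  lra.
lra.
Qed.

(* Density increment by the factor [1 + 1/D].  If no progression carried it, the
   middle third would hold about a third of [B], and its energy would be too small
   for Cauchy-Schwarz on the large spectrum. *)
Lemma roth_step D K k' k (B : pred nat) (N := 3 ^ k) (l := 3 ^ k') :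
  200 <= D -> 0 < K ->
  ap3_free B N -> N <= K * cnt B N ->
  2 * D * K ^ 2 * l * ((40 * l).+1 ^ 2) ^ (16 * 16 * K ^ 3) <= N ->
  exists q y, 0 < q /\ D.+1 * cnt B N * l <= D * N * cnt (back_ap B q y) l.
Proof.
move=> D200 K0 free dens big; apply: contrapT => hno.
have D0 : 0 < D by apply: leq_trans D200.
have l0 : 0 < l by rewrite expn_gt0.
have N0 : 0 < N by rewrite expn_gt0.
(* If the increment fails, every count along a progression is at most [m]. *)
set b := cnt B N in dens *; pose m := (D.+1 * b * l) %/ (D * N).
have hm q y : 0 < q -> cnt (back_ap B q y) l <= m.
  move=> q0; rewrite leq_divRL ?muln_gt0 ?D0 ?N0 //.
  rewrite leqNgt; apply/negP => h; apply: hno; exists q, y; split=> //.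
  by rewrite [leqRHS]mulnC ltnW.
have hmN : m * (D * N) <= D.+1 * b * l by apply: leq_trunc_div.
have lN8 : 2 * D * K ^ 2 * l <= N.
  by apply: leq_trans big; rewrite leq_pmulr // !expn_gt0.
have K2 : 0 < K ^ 2 by rewrite expn_gt0 K0.
have lN : l < N.
  apply: leq_trans lN8; rewrite -[l.+1]add1n.
  apply: leq_trans (_ : 2 * l <= _); first by rewrite mul2n -addnn leq_add2r.
  rewrite leq_mul2r; apply/orP; right.
  by rewrite -mulnA leq_pmulr // muln_gt0 D0.
have ltk : k' < k by rewrite -(ltn_exp2l k' k (isT : 1 < 3)).
(* Powers of 3 make [N] odd and its thirds multiples of [l]. *)
pose n := 3 ^ k.-1.
have Nn : N = 3 * n by rewrite /n -expnS prednK //; apply: leq_ltn_trans ltk.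
have n0 : 0 < n by rewrite expn_gt0.
have oN : odd N by rewrite oddX orbT.
pose B1 : pred nat := fun x => B x && (n <= x < 2 * n).
set b1 := cnt B1 N.
have b1_ge : 3 * b <= 10 * b1.
  pose c := 3 ^ (k.-1 - k').
  have nc : n = c * l by rewrite /n /c /l -expnD subnK // -ltnS prednK // (leq_ltn_trans _ ltk).
  have out a : \sum_(x < n) B (a + x) <= c * m.
    by rewrite nc; apply: cnt_interval_le => y; apply: hm.
  apply: (middle_third_ge (x := c * m) D200) (out 0) (out (2 * n)) _; last first.
    by have := cnt_thirds B n; rewrite /= -Nn.
  rewrite -(leq_pmul2r n0).
  apply: leq_trans (_ : c * (m * (D * N)) <= _).
    by rewrite Nn -!mulnA (mulnCA 3 D n).
  apply: leq_trans (_ : c * (D.+1 * b * l) <= _); first by rewrite leq_mul2l hmN orbT.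
  by rewrite nc mulnCA.
have b1_ge4 : b <= 4 * b1 by clear -b1_ge; lia.
have b_gt0 : 0 < b by case: (posnP b) dens => // ->; rewrite muln0 leqNgt N0.
have b1_gt0 : 0 < b1 by clear -b1_ge b_gt0; lia.
have N12 : 2 * N <= b1 * b.
  apply: dense_mul_ge K0 dens _ b1_ge4.
  apply: leq_trans lN8; apply: leq_trans (_ : 2 * D * K ^ 2 <= _).
    rewrite leq_mul2r; apply/orP; right.
    by rewrite (leq_mul2l 2 4 D) /= (leq_trans _ D200).
  by rewrite leq_pmulr.
clear ltk; clearbody N l n.
have [z zN] := C_prim_root_exists N0.
pose tau : algR := (b1%:R * b%:R / (4%:R * N%:R))%R.
pose spec := spectrum N z B tau.
have NR : (0 < N%:R :> algR)%R by rewrite ltr0n.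
have bR : (0 < b%:R :> algR)%R by rewrite ltr0n.
have b1R : (0 < b1%:R :> algR)%R by rewrite ltr0n.
have lR : (0 < l%:R :> algR)%R by rewrite ltr0n.
have tau0 : (0 <= tau)%R by rewrite divr_ge0 ?mulr_ge0 ?ler0n.
have card_spec : #|spec| <= 16 * 16 * K ^ 3.
  have := card_spectrum zN B tau0; rewrite -/spec -/b.
  have -> : (#|spec|%:R * tau ^+ 2 =
     (#|spec| * (b1 * b) ^ 2)%N%:R / (16 * N ^ 2)%N%:R :> algR)%R.
    by rewrite /tau !natrM ?natrX ?natrM; field; rewrite gt_eqF.
  rewrite ler_pdivrMr ?ltr0n ?muln_gt0 ?expn_gt0 ?N0 // -natrM ler_nat => h.
  exact: spectrum_size_le b_gt0 dens b1_ge4 h.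
pose s := [seq nat_of_ord t | t <- enum spec].
(* Mesh $1/(20l)$ keeps every character of the spectrum within $1/10$ of 1 along the progression. *)
have l20 : 0 < 20 * l by rewrite muln_gt0.
have [q [q0 qQ hq]] := prim_root_recurrence (s := s) zN l20 (erefl _).
have lq : 2 * D * K ^ 2 * (l * q) <= N.
  rewrite mulnA; apply: leq_trans big; rewrite leq_mul2l; apply/orP; right.
  apply: leq_trans qQ _; rewrite size_map -cardE mulnA (_ : 2 * 20 = 40) //.
  by rewrite leq_exp2l // -{1}(exp1n 2) ltn_exp2r // ltnS muln_gt0.
have lqN : l * q <= N.
  by apply: leq_trans lq; rewrite leq_pmull // muln_gt0 K2 muln_gt0 D0.
have lqb : 2 * D * (l * q) * N <= b * b.
  by apply: dense_wrap_le K0 dens _; rewrite mulnA (mulnC (K ^ 2)).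
pose P (t : nat) := abs (\sum_(j < l) z ^+ (t * (j * q)))%R.
have Pge (t : 'I_N) : t \in spec -> (4%:R / 5%:R * l%:R ^+ 2 <= P t ^+ 2)%R.
  move=> ts; have := abs_progression_sum_ge (t := t) (q := q) (l := l) zN.
  rewrite -/(P t) => /(_ (hq t _)) h.
  have {}h : (9%:R / 10%:R * l%:R <= P t)%R by apply: h; rewrite map_f ?mem_enum.
  apply: le_trans (_ : (9%:R / 10%:R * l%:R) ^+ 2 <= _)%R; first by have := sqr_ge0 (l%:R : algR); lra.
  by rewrite ler_pXn2r ?nnegrE ?abs_ge0 ?mulr_ge0 ?invr_ge0 ?ler0n.
have P0 : P 0%N = l%:R%R.
  rewrite /P; under eq_bigr do rewrite mul0n expr0.
  by rewrite sumr_const card_ord abs_nat.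
pose H := fsum N z.
pose S1 := (\sum_(t in spec) abs (H B1 t) ^+ 2)%R.
pose S2 := (\sum_(t in spec) abs (H B t) ^+ 2)%R.
pose S12 := (\sum_(t in spec) abs (H B1 t) * abs (H B t))%R.
have hS1 : (4%:R / 5%:R * l%:R ^+ 2 * S1 <= (N * energy N l q B1)%N%:R)%R.
  rewrite -(sum_abs_fsum_energy zN) [leRHS](bigID (mem spec)) -[leLHS]addr0.
  apply: lerD; last by apply: sumr_ge0 => t _; rewrite mulr_ge0 ?sqr_ge0.
  rewrite /S1 big_distrr; apply: ler_sum => t ts /=.
  by rewrite mulrC ler_wpM2l ?sqr_ge0 // Pge.
(* Frequency 0, outside the spectrum, supplies the extra $b^2l^2$. *)
have hS2 : (b%:R ^+ 2 * l%:R ^+ 2 + 4%:R / 5%:R * l%:R ^+ 2 * S2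
             <= (N * energy N l q B)%N%:R)%R.
  rewrite -(sum_abs_fsum_energy zN) (bigD1 (Ordinal N0)) //= fsum0 abs_nat.
  have := P0; rewrite /P => ->; rewrite lerD2l.
  rewrite /S2 big_distrr big_mkcond [leRHS]big_mkcond; apply: ler_sum => t _ /=.
  case: ifP => ts; last by case: (_ != _) => //; rewrite mulr_ge0 ?sqr_ge0.
  have -> : t != Ordinal N0 by move: ts; rewrite inE -val_eqE => /andP [].
  by rewrite mulrC ler_wpM2l ?sqr_ge0 // Pge.
have hm1 y : cnt (back_ap B1 q y) l <= m.
  apply: leq_trans (hm q y q0); apply: leq_sum => j _.
  by rewrite /back_ap /B1 andbA; case: (_ && B _) => //=; apply: leq_b1.
have E1 := energy_upper (energy_le lqN hm1) hmN lqb.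
have E2 := energy_upper (energy_le lqN (fun y => hm q y q0)) hmN lqb.
have l2 : (0 < l%:R ^+ 2 :> algR)%R by rewrite exprn_gt0.
have DR : (0 <= D%:R :> algR)%R by rewrite ler0n.
apply: (@increment_numeric algR D%:R (b1%:R * b%:R) (b%:R * b%:R) S1 S2 S12)%R.
- by rewrite ler_nat.
- by rewrite mulr_gt0.
- by rewrite -!natrM ler_nat !mulnA leq_mul2r b1_ge orbT.
- rewrite -(ler_pM2l l2).
  move: E1; rewrite -(ler_nat algR) natrM => E1.
  have := le_trans (ler_wpM2l DR hS1) E1.
  rewrite -/b1 -/b !natrM natrD !natrM -natr1; lra.
- rewrite -(ler_pM2l l2).
  move: E2; rewrite -(ler_nat algR) natrM => E2.
  have := le_trans (ler_wpM2l DR hS2) E2.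
  rewrite -/b !natrM natrD !natrM -natr1; lra.
- apply: (sum_spectrum_ge zN Nn oN free) => //.
  by rewrite -!natrM ler_nat.
(* $2xy\le x^2/5+5y^2$, weighted because the bound on [S2] is much smaller than that on [S1]. *)
rewrite /S12 /S1 /S2 !big_distrr big_distrl -big_split; apply: ler_sum => t _ /=.
have := sqr_ge0 (abs (H B1 t) - 5%:R * abs (H B t))%R; lra.
Qed.

(** * Iteration of the density increment *)

Lemma cnt_le B n : cnt B n <= n.
Proof.
rewrite -[leqRHS]card_ord -sum1_card.
by apply: leq_sum => i _; apply: leq_b1.
Qed.

(** Logarithm to base 3 of a length that permits [j] increments from density $1/K$; the recursion is
    the length condition of one increment. *)
Fixpoint roth_exponent (K j : nat) : nat :=
  if j is j'.+1 then (roth_exponent K j' + 4) * (4 * (16 * 16 * K ^ 3)) else 0.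

Lemma roth_step_length K k' (l := 3 ^ k') : 0 < K ->
  2 * 2 ^ 8 * K ^ 2 * l * ((40 * l).+1 ^ 2) ^ (16 * 16 * K ^ 3)
    <= 3 ^ ((k' + 4) * (4 * (16 * 16 * K ^ 3))).
Proof.
move=> K0; set X := 16 * 16 * K ^ 3.
have l0 : 0 < l by rewrite expn_gt0.
have X1 : 0 < X by rewrite /X muln_gt0 expn_gt0 K0.
have KX : K ^ 2 <= X.
  apply: leq_trans (_ : K ^ 3 <= _); first by rewrite leq_pexp2l.
  by rewrite /X leq_pmull.
clearbody X.
have K3 : K ^ 2 <= 3 ^ X by apply: leq_trans KX (ltnW (ltn_expl _ _)).
have l81 : (40 * l).+1 <= 3 ^ (k' + 4).
  by rewrite expnD -/l; move: l0; clear; move: (l) => x; rewrite (_ : 3 ^ 4 = 81) //; lia.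
have big : ((40 * l).+1 ^ 2) ^ X <= 3 ^ ((k' + 4) * (2 * X)).
  by rewrite -expnM [leqRHS]expnM leq_exp2r ?muln_gt0.
apply: leq_trans (_ : 3 ^ 6 * 3 ^ X * 3 ^ k' * 3 ^ ((k' + 4) * (2 * X)) <= _).
  by apply: leq_mul big; apply: leq_mul (leqnn _); apply: leq_mul K3.
rewrite -!expnD leq_exp2l //.
by move: X1; clear; nia.
Qed.

(** Progressions of indices become progressions of points in reverse order. The cut at [N] matters
    because [y] may exceed [N]. *)
Lemma back_ap_free B N q y l : ap3_free (fun x => B x && (x < N)) N -> 0 < q ->
  ap3_free (back_ap (fun x => B x && (x < N)) q y) l.
Proof.
move=> free q0 x d d0 _; apply/negP => /and3P [].
rewrite /back_ap => /and3P [xy Bx xN] /and3P [_ Bxd _] /and3P [xdy Bx2d _].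
have e1 : (x + d) * q + d * q = (x + 2 * d) * q by rewrite -mulnDl; congr (_ * _); lia.
have e2 : x * q + d * q = (x + d) * q by rewrite mulnDl.
have dq : 0 < d * q by rewrite muln_gt0 d0.
have := free (y - (x + 2 * d) * q) (d * q) dq.
rewrite (_ : y - (x + 2 * d) * q + d * q = y - (x + d) * q); last by lia.
rewrite (_ : y - (x + 2 * d) * q + 2 * (d * q) = y - x * q); last by lia.
rewrite xN => /(_ isT); rewrite Bx2d Bxd Bx /=.
by rewrite (leq_ltn_trans _ xN) ?(leq_ltn_trans _ xN) //; lia.
Qed.

Lemma cnt_restrict B n : cnt (fun x => B x && (x < n)) n = cnt B n.
Proof. by apply: eq_bigr => x _; rewrite ltn_ord andbT. Qed.

(** Each increment multiplies the density by at least $1+2^{-8}$, so the lower bound $1/K$ persists;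
    at the end the density is at most 1. *)
Lemma roth_iter K j (B : pred nat) (N := 3 ^ roth_exponent K j) : 0 < K ->
  ap3_free B N -> N <= K * cnt B N ->
  (2 ^ 8).+1 ^ j * cnt B N <= (2 ^ 8) ^ j * N.
Proof.
rewrite {}/N; have : 200 <= 2 ^ 8 by [].
move: (2 ^ 8) (@roth_step_length K) => D len D200 K0.
elim: j B => [|j IH] B; first by rewrite !expn0 !mul1n => _ _; apply: cnt_le.
set N := 3 ^ _; set l := 3 ^ roth_exponent K j in IH.
move=> free dens.
pose BN : pred nat := fun x => B x && (x < N).
have freeN : ap3_free BN N.
  move=> x d d0 xd; have := free x d d0 xd; apply: contra.
  by rewrite /BN => /and3P [/andP [-> _] /andP [-> _] /andP [-> _]].
have [q [y [q0 hq]]] : exists q y, 0 < q /\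
    D.+1 * cnt BN N * l <= D * N * cnt (back_ap BN q y) l.
  apply: (@roth_step D K (roth_exponent K j)) => //; first by rewrite cnt_restrict.
  exact: len.
rewrite cnt_restrict in hq; set b := cnt B N in dens hq *.
set b' := cnt _ l in hq.
have l0 : 0 < l by rewrite expn_gt0.
have N0 : 0 < N by rewrite expn_gt0.
have D0 : 0 < D by apply: leq_trans D200.
have dens' : l <= K * b'.
  have h1 : K * (D.+1 * b * l) <= K * (D * N * b') by rewrite leq_mul2l hq orbT.
  have h2 : N * (D * l) <= K * b * (D * l) by rewrite leq_mul2r dens orbT.
  have h3 : K * b * (D * l) <= K * b * (D.+1 * l).
    by rewrite !leq_mul2l leq_mul2r leqnSn !orbT.
  have : D * N * l <= D * N * (K * b') by lia.
  by rewrite leq_pmul2l // muln_gt0 D0.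
have := IH _ (@back_ap_free B N q y l freeN q0) dens'; rewrite -/b' => h.
rewrite -(leq_pmul2r l0) !expnS.
apply: leq_trans (_ : D.+1 ^ j * (D * N * b') <= _).
  by rewrite (mulnC D.+1) -!mulnA leq_mul2l !mulnA hq orbT.
rewrite mulnCA (mulnAC D (D ^ j) N) -(mulnA (D * N)) leq_mul2l.
by rewrite h orbT.
Qed.

(** Bernoulli's inequality $(1+1/D)^n\ge 1+n/D$ without denominators; for $n=D$ it shows that [D]
    increments double the density. *)
Lemma bernoulli_nat D n : D ^ n * (D + n) <= D.+1 ^ n * D.
Proof.
elim: n => [|n IH]; first by rewrite !expn0 addn0.
rewrite !expnS.
have h : D.+1 * (D ^ n * (D + n)) <= D.+1 * (D.+1 ^ n * D) by rewrite leq_mul2l IH orbT.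
by move: h; move: (D ^ n) (D.+1 ^ n) => x w; nia.
Qed.

(** As [2 ^ 8] increments double the density, [2 ^ 8 * e.+1] of them would raise $2^{-e}$ to 2. *)
Definition roth_length (e : nat) : nat := 3 ^ roth_exponent (2 ^ e) (2 ^ 8 * e.+1).

Lemma roth e (B : pred nat) (N := roth_length e) : N <= 2 ^ e * cnt B N ->
  exists x d, [/\ 0 < d, x + 2 * d < N & [/\ B x, B (x + d) & B (x + 2 * d)]].
Proof.
move=> dens; apply: contrapT => hno.
have free : ap3_free B N.
  move=> x d d0 xd; apply/negP => /and3P [h1 h2 h3]; apply: hno.
  by exists x, d.
have N0 : 0 < N by rewrite expn_gt0.
have b0 : 0 < cnt B N.
  by case: (posnP (cnt B N)) dens => // ->; rewrite muln0 leqNgt N0.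
have : (2 ^ 8).+1 ^ (2 ^ 8 * e.+1) * cnt B N <= (2 ^ 8) ^ (2 ^ 8 * e.+1) * N.
  exact: (roth_iter (expn_gt0 2 e) free dens).
apply/negP; rewrite -ltnNge; clearbody N; clear hno free.
move: (2 ^ 8) (bernoulli_nat (2 ^ 8) (2 ^ 8)) (isT : 0 < 2 ^ 8) => D hD D0.
have {}hD : 2 * D ^ D <= D.+1 ^ D.
  by rewrite -(leq_pmul2r D0); move: hD; move: (D ^ D) => x; nia.
have hj : 2 ^ e.+1 * D ^ (D * e.+1) <= D.+1 ^ (D * e.+1).
  by rewrite !expnM -expnMn leq_exp2r.
apply: (@leq_trans (2 ^ e.+1 * D ^ (D * e.+1) * cnt B N)); last first.
  by rewrite leq_mul2r hj orbT.
rewrite mulnAC [X in X < _]mulnC ltn_pmul2r ?expn_gt0 ?D0 //.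
apply: leq_ltn_trans dens _; rewrite ltn_pmul2r // ltn_exp2l //.
Qed.

(** The summand 4 makes the recursion geometric, at the price of a factor 2 in the ratio. *)
Lemma roth_exponent_le K j : 0 < K ->
  roth_exponent K j + 4 <= 4 * (2 ^ 11 * K ^ 3) ^ j.
Proof.
move=> K0; elim: j => [|j IH] //.
have K3 : 0 < K ^ 3 by rewrite expn_gt0 K0.
have -> : roth_exponent K j.+1 = (roth_exponent K j + 4) * (2 ^ 10 * K ^ 3).
  by congr (_ * _); rewrite (mulnA 4).
apply: leq_trans (_ : (roth_exponent K j + 4) * (2 ^ 11 * K ^ 3) <= _).
  rewrite (expnS 2 10) -(mulnA 2) (mulnCA _ 2) mul2n -addnn leq_add2l.
  by rewrite -{1}[4]muln1 leq_mul ?leq_addl // muln_gt0 expn_gt0.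
by rewrite [_ ^ j.+1]expnS mulnC (mulnCA 4) leq_mul2l IH orbT.
Qed.

(** There are $O(e)$ increments, each of which multiplies the logarithm of the length by
    $2^{O(e+1)}$; hence the quadratic exponent. *)
Lemma roth_length_le e : roth_length e <= 2 ^ 2 ^ (2 ^ 12 * e.+1 ^ 2).
Proof.
rewrite /roth_length; set j := 2 ^ 8 * e.+1; set k := roth_exponent _ _.
have hk : k <= 2 ^ (2 + (11 + 3 * e) * j).
  have := @roth_exponent_le (2 ^ e) j (expn_gt0 2 e); rewrite -/k => h.
  apply: leq_trans (leq_addr 4 k) (leq_trans h _).
  by rewrite -!expnM -expnD -expnM expnD mulnC (mulnC e) mulnC.
apply: leq_trans (_ : 2 ^ (2 * k) <= _).
  by rewrite expnM; case: (k) => // k'; rewrite leq_exp2r.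
rewrite leq_exp2l // -[2 * k]/(2 ^ 1 * k).
apply: leq_trans (_ : 2 ^ 1 * 2 ^ (2 + (11 + 3 * e) * j) <= _).
  by rewrite leq_mul2l hk orbT.
rewrite -expnD leq_exp2l // /j !expnS !expn0; lia.
Qed.

(** * Elimination of colours *)

Lemma cnt_shift_ge (A : pred nat) N s T : s + N <= T ->
  cnt A N <= cnt (fun y => (s <= y) && A (y - s)) T.
Proof.
move=> sNT; rewrite /cnt -(subnKC sNT) big_split_ord big_split_ord /=.
rewrite -addnA addnCA; apply: leq_trans (leq_addr _ _).
by apply: leq_sum => a _; rewrite leq_addr addKn.
Qed.

(* Average over [y < 2N]. *)
Lemma exists_dense_shift (U A : pred nat) N L S (s : nat -> nat) : 0 < N ->
  S <= N -> (forall u, s u <= S) ->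
  exists y, cnt U L * cnt A N <=
    2 * N * cnt (fun u => U u && ((s u <= y) && A (y - s u))) L.
Proof.
move=> N0 SN hs; apply: contrapT => hno.
have hlt y : 2 * N * cnt (fun u => U u && ((s u <= y) && A (y - s u))) L
    < cnt U L * cnt A N.
  by rewrite ltnNge; apply/negP => h; apply: hno; exists y.
have : \sum_(y < 2 * N) (2 * N * cnt (fun u => U u && ((s u <= y) && A (y - s u))) L)
    < \sum_(y < 2 * N) (cnt U L * cnt A N).
  have N2 : 0 < 2 * N by rewrite muln_gt0.
  rewrite (bigD1 (Ordinal N2)) //= [ltnRHS](bigD1 (Ordinal N2)) //=.
  by rewrite -addSn leq_add ?hlt //; apply: leq_sum => y _; apply: ltnW.
rewrite sum_nat_const card_ord -big_distrr /= ltn_pmul2l ?muln_gt0 // ltnNge.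
case/negP; rewrite /cnt exchange_big big_distrl /=; apply: leq_sum => u _.
case: (U u); rewrite ?mul0n // mul1n.
by apply: (@cnt_shift_ge A N (s u)); rewrite mul2n -addnn leq_add2r (leq_trans (hs u)).
Qed.

(** The pairs are treated one by one, each at the cost of a factor [2 * rho] in density. The point
    attached to [u] is affine in [u] with slope [m], so a progression of difference [D] in [U] gives
    one of difference [m * D] in [A k]; the offset [M * L] keeps the shifts natural. *)
Lemma exists_dense_fibre (A : bool -> pred nat) rho N L M (ps : seq (nat * bool)) :
  0 < N -> M * L <= N -> (forall k, N <= rho * cnt (A k) N) ->
  exists U : pred nat, L <= (2 * rho) ^ size ps * cnt U L /\
    forall m k, (m, k) \in ps -> exists y, forall u, U u ->
      (M * L - m * u <= y) && A k (y - (M * L - m * u)).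
Proof.
move=> N0 MLN dens; elim: ps => [|[m k] ps [U [dU hU]]].
  exists predT; split=> //; rewrite expn0 mul1n /cnt sum_nat_const card_ord muln1 //.
have [y] := @exists_dense_shift U (A k) N L (M * L) (fun u => M * L - m * u)
  N0 MLN (fun u => leq_subr _ _).
set U' := (fun u => _) => hy; exists U'; split; last first.
  move=> m' k'; rewrite inE => /orP [/eqP [-> ->]|/hU [y' hy']].
    by exists y => u /andP [].
  by exists y' => u /andP [/hy'].
rewrite /= expnS; move: (cnt U' L) (cnt U L) (_ ^ _) hy dU (dens k) => x w p.
move: (cnt _ _) => a hx dU da; rewrite -(leq_pmul2r N0).
apply: leq_trans (_ : p * w * (rho * a) <= _); first exact: leq_mul.
apply: leq_trans (_ : p * rho * (2 * N * x) <= _); last by lia.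
have := leq_mul (leqnn (p * rho)) hx; lia.
Qed.

Lemma common_differences (A : bool -> pred nat) rho e N M :
  0 < N -> M * roth_length e <= N -> (2 * rho) ^ (M * 2) <= 2 ^ e ->
  (forall k, N <= rho * cnt (A k) N) ->
  exists D, 0 < D /\ forall m k, 0 < m <= M -> exists a,
    [/\ A k a, A k (a + m * D) & A k (a + 2 * (m * D))].
Proof.
move=> N0 MLN he dens; set L := roth_length e in MLN.
pose ps := [seq (m, k) | m <- iota 1 M, k <- [:: true; false]].
have [U [dU hU]] := exists_dense_fibre ps N0 MLN dens.
have [] := @roth e U.
  apply: leq_trans dU _; rewrite leq_mul2r size_allpairs size_iota he orbT //.
move=> u [D [D0 uL [h0 h1 h2]]]; exists D; split=> // m k /andP [m0 mM].
have [|y hy] := hU m k.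
  by apply/allpairsP; exists (m, k); rewrite mem_iota m0 add1n ltnS mM; case: k.
have uM v : v < L -> m * v <= M * L by move=> vL; apply: leq_mul (ltnW vL).
have l0 : m * u <= M * L by apply: uM; rewrite -/L in uL; lia.
have l1 : m * (u + D) <= M * L by apply: uM; rewrite -/L in uL; lia.
have l2 : m * (u + 2 * D) <= M * L by apply: uM.
have := hy _ h0; have := hy _ h1; have := hy _ h2.
rewrite mulnDr (mulnDr m u) mulnCA in l1 l2 *; set ML := M * L in l0 l1 l2 *.
move=> /andP [b2 A2] /andP [b1 A1] /andP [b0 A0].
exists (y - (ML - m * u)); split=> //.
  by move: A1; congr (A k _); move: b0 b1 l0 l1; clear; lia.
by move: A2; congr (A k _); move: b0 b2 l0 l2; clear; lia.
Qed.

(** The colour type stays fixed and only the set [J] of available colours shrinks, which permits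
    induction on [s]. *)
Definition brauer_upto r s N := forall (c : nat -> 'I_r) (J : {set 'I_r}), #|J| <= s ->
  (forall x, 0 < x <= N -> c x \in J) ->
  exists x d, [/\ 0 < x, 0 < d, x + 2 * d <= N
        & [/\ c d = c x, c (x + d) = c x & c (x + 2 * d) = c x]].

(** * Dense colour classes *)

Section Recursion.
Variables (r : nat) (c : nat -> 'I_r) (N : nat).

Definition colour_class (i : 'I_r) : pred nat := fun a => (c a.+1 == i) && (a < N).

Lemma sum_cnt_colour_class : \sum_(i < r) cnt (colour_class i) N = N.
Proof.
rewrite /cnt exchange_big /= -[RHS]card_ord -sum1_card; apply: eq_bigr => a _.
rewrite (bigD1 (c a.+1)) //= /colour_class eqxx ltn_ord big1 // => i.
by rewrite eq_sym => /negPf ->.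
Qed.

(** On [N - 2 * d] points the translates by 0, [d] and [2 * d] each have more than $3N/4-2d$
    elements. If no point lay in all three, $3(3N/4-2d)<2(N-2d)$ would follow, that is $N<8d$. *)
Lemma dense_class_differences i d : 3 * N < 4 * cnt (colour_class i) N -> 16 * d <= N ->
  exists a, [/\ colour_class i a, colour_class i (a + d) & colour_class i (a + 2 * d)].
Proof.
move=> dens dN; apply: contrapT => hno.
set A := colour_class i in dens hno.
have AN a : A a -> a < N by case/andP.
pose n := N - 2 * d.
have part s : s <= 2 * d -> cnt A N <= \sum_(a < n) A (a + s) + 2 * d.
  move=> sd; have eN : s + (n + (2 * d - s)) = N by rewrite /n; lia.
  have gen t : cnt A (s + (n + t)) <= \sum_(a < n) A (a + s) + (s + t).
    rewrite /cnt !big_split_ord /= addnCA leq_add //.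
      by apply: leq_sum => a _; rewrite addnC.
    by apply: leq_add; [exact: cnt_le|exact: (cnt_le (fun a => A (s + (n + a))))].
  by have := gen (2 * d - s); rewrite eN subnKC.
have h0 := part 0 isT; have h1 := part d _; have h2 := part (2 * d) (leqnn _).
have {}h1 : cnt A N <= \sum_(a < n) A (a + d) + 2 * d by apply: h1; lia.
have : \sum_(a < n) A (a + 0) + \sum_(a < n) A (a + d) + \sum_(a < n) A (a + 2 * d)
     <= 2 * n.
  rewrite -!big_split /=; apply: leq_trans (_ : \sum_(a < n) 2 <= _); last first.
    by rewrite sum_nat_const card_ord mulnC.
  apply: leq_sum => a _; rewrite addn0.
  case e0: (A a); case e1: (A (a + d)); case e2: (A (a + 2 * d)) => //.
  by case: hno; exists a.
have en : n + 2 * d = N by rewrite /n; lia.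
clearbody n; lia.
Qed.

Lemma popular_class : 0 < r -> exists i, N <= r * cnt (colour_class i) N.
Proof.
move=> r0; apply: contrapT => hno.
have [i0] : exists i0 : 'I_r, True by exists (Ordinal r0).
have lt i : r * cnt (colour_class i) N < N.
  by rewrite ltnNge; apply/negP => h; apply: hno; exists i.
have : \sum_(i < r) (r * cnt (colour_class i) N) < \sum_(i < r) N.
  rewrite (bigD1 i0) //= [ltnRHS](bigD1 i0) //= -addSn leq_add ?lt //.
  by apply: leq_sum => i _; apply: ltnW.
by rewrite -big_distrr /= sum_cnt_colour_class sum_nat_const card_ord ltnn.
Qed.

(** The other colours, fewer than [r], share at least a quarter of the points. *)
Lemma second_class i : 0 < N -> 4 * cnt (colour_class i) N <= 3 * N ->
  exists2 i', i' != i & N <= 4 * r * cnt (colour_class i') N.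
Proof.
move=> N0 hi; apply: contrapT => hno.
have lt i' : i' != i -> 4 * r * cnt (colour_class i') N <= N.
  by move=> ne; rewrite leqNgt; apply/negP => h; apply: hno; exists i' => //; apply: ltnW.
have h1 : \sum_(i' < r | i' != i) 4 * r * cnt (colour_class i') N <= r.-1 * N.
  apply: (@leq_trans (\sum_(i' < r | i' != i) N)); first exact: leq_sum.
  rewrite sum_nat_const leq_mul2r; apply/orP; right.
  by have := cardC1 i; rewrite card_ord => <-.
have := sum_cnt_colour_class; rewrite (bigD1 i) //=.
rewrite -big_distrr /= in h1; move: h1; set S := \sum_(_ < _ | _) _ => h1 e.
have r0 : 0 < r by apply: leq_ltn_trans (ltn_ord i).
have : r * N <= 4 * r * S by rewrite -mulnA mulnCA leq_mul2l; apply/orP; right; lia.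
by move=> h2; have := leq_trans h2 h1; rewrite leq_mul2r; lia.
Qed.

End Recursion.

(* [M] serves the elimination of two colours, [M'] that of a dominant one. *)
Lemma brauer_step r s M M' N e : 0 < r -> 0 < N -> brauer_upto r s M' ->
  (0 < s -> 0 < M /\ brauer_upto r s.-1 M) -> 16 * M' <= N ->
  M * roth_length e <= N -> (2 * (4 * r)) ^ (M * 2) <= 2 ^ e ->
  brauer_upto r s.+1 N.
Proof.
move=> r0 N0 Brs Brs1 M'N MN he c J cardJ hJ; apply: contrapT => hno.
(* A progression of colour [i] and difference [d] becomes a Brauer configuration as soon as [d] has
   colour [i] too. *)
have avoid i a d : 0 < d -> colour_class c N i a -> colour_class c N i (a + d) ->
    colour_class c N i (a + 2 * d) -> c d != i.
  move=> d0 /andP [/eqP c0 _] /andP [/eqP c1 _] /andP [/eqP c2 lt].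
  apply/eqP => cd; apply: hno; exists a.+1, d.
  by rewrite !addSn c0 c1 c2 cd.
have inJ i : 0 < cnt (colour_class c N i) N -> i \in J.
  rewrite lt0n sum_nat_eq0 negb_forall => /existsP [a]; rewrite eqb0 negbK.
  by case/andP => /eqP <- _; apply: hJ; rewrite ltn0Sn ltn_ord.
have [[i hi]|noA] := pselect (exists i, 3 * N < 4 * cnt (colour_class c N i) N).
  have iJ : i \in J by apply: inJ; lia.
  have [||x [d [x0 d0 xd hc]]] := Brs c (J :\ i).
  - by have := cardJ; rewrite (cardsD1 i J) iJ add1n ltnS.
  - move=> d /andP [d0 dM]; rewrite !inE.
    have [|a [a0 a1 a2]] := @dense_class_differences r c N i d hi; first by lia.
    by rewrite (avoid i a d) // hJ // d0; lia.
  by apply: hno; exists x, d; split=> //; lia.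
have noA' i : 4 * cnt (colour_class c N i) N <= 3 * N.
  by rewrite leqNgt; apply/negP => h; apply: noA; exists i.
have [i hi] := popular_class c N r0.
have [i' ne hi'] := second_class N0 (noA' i).
have iJ : i \in J by apply: inJ; case: (posnP (cnt _ _)) hi => // ->; rewrite muln0; lia.
have i'J : i' \in J by apply: inJ; case: (posnP (cnt _ _)) hi' => // ->; rewrite muln0; lia.
(* Two distinct colours of [J] force [0 < s], which releases the hypothesis on [M]. *)
have card2 : #|J :\ i :\ i'| <= s.-1 /\ 0 < s.
  have := cardJ; rewrite (cardsD1 i J) iJ (cardsD1 i' (J :\ i)) !inE ne i'J.
  by rewrite !add1n ltnS; case: (s).
have [M0 BrM] := Brs1 (proj2 card2).
have [|D [D0 hD]] := @common_differences (fun k => colour_class c N (if k then i else i'))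
  (4 * r) e N M N0 MN he.
  case=> //; apply: leq_trans hi _; rewrite leq_mul2r; apply/orP; right.
  by rewrite leq_pmull.
have DM : D * M <= N.
  have [|a [_ _ /andP [_ lt]]] := hD M true; first by rewrite M0 leqnn.
  by rewrite mulnC; lia.
(* Brauer configurations are invariant under dilation, so the colouring of the multiples of [D] may
   be used. *)
have [||x [d [x0 d0 xd hc]]] := BrM (fun x => c (D * x)) (J :\ i :\ i').
- exact: proj1 card2.
- move=> m /andP [m0 mM].
  have mD0 : 0 < m * D by rewrite muln_gt0 m0.
  have mMM : 0 < m <= M by rewrite m0.
  have [a [a0 a1 a2]] := hD m true mMM; have [b [b0 b1 b2]] := hD m false mMM.
  rewrite !inE mulnC (avoid i a) // (avoid i' b) // hJ // mD0 /=.
  by apply: leq_trans DM; rewrite mulnC leq_mul2l mM orbT.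
apply: hno; exists (D * x), (D * d); rewrite !muln_gt0 D0 x0 d0.
rewrite -mulnDr mulnCA -mulnDr; split=> //.
by apply: leq_trans DM; rewrite leq_mul2l xd orbT.
Qed.

(* The cube absorbs all polynomial losses: two steps from [M] give
   [2^(2^(3 M^3))], which exceeds the length needed for two colours. *)
Fixpoint brauer_bound (r s : nat) : nat :=
  if s is s'.+1 then 2 ^ (brauer_bound r s') ^ 3 else (2 ^ 12 * (2 * r + 7) ^ 2).+1.

Lemma brauer_bound_ge r s : (2 ^ 12 * (2 * r + 7) ^ 2).+1 <= brauer_bound r s.
Proof.
elim: s => [|s IH] //=; apply: leq_trans IH _.
apply: leq_trans (ltnW (ltn_expl _ (isT : 1 < 2))) _.
rewrite leq_exp2l //; case: (brauer_bound r s) => // u.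
by rewrite -{1}[u.+1]expn1 leq_pexp2l.
Qed.

(** The iterated logarithm of the length is at most $2^{12}(2r+7)^2M^2$, which is less than $M^3$
    for such [M]. *)
Lemma roth_length_two_steps r M : (2 ^ 12 * (2 * r + 7) ^ 2).+1 <= M ->
  M * roth_length ((3 + r) * (M * 2)) <= 2 ^ (2 ^ M ^ 3) ^ 3.
Proof.
move=> hM; have M0 : 0 < M by apply: leq_trans hM.
set e := (3 + r) * (M * 2).
have he : e.+1 <= (2 * r + 7) * M by rewrite /e; lia.
pose X := 2 ^ 12 * (2 * r + 7) ^ 2 * M ^ 2.
have hL : roth_length e <= 2 ^ 2 ^ X.
  apply: leq_trans (roth_length_le e) _; rewrite !leq_exp2l // /X -mulnA -expnMn.
  by rewrite leq_mul2l leq_exp2r // he orbT.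
have hX : X.+1 <= M ^ 3.
  have M2 : 0 < M ^ 2 by rewrite expn_gt0 M0.
  apply: leq_trans (_ : (2 ^ 12 * (2 * r + 7) ^ 2).+1 * M ^ 2 <= _).
    by rewrite mulSn -addn1 addnC leq_add.
  by rewrite (expnS M 2) leq_mul2r hM orbT.
have MX : M <= 2 ^ X.
  apply: leq_trans (ltnW (ltn_expl M (isT : 1 < 2))) _; rewrite leq_exp2l // /X.
  apply: leq_trans (_ : M ^ 2 <= _); first by rewrite -{1}[M]expn1 leq_pexp2l.
  by rewrite leq_pmull // muln_gt0 !expn_gt0 addnS.
apply: leq_trans (_ : 2 ^ M * 2 ^ 2 ^ X <= _).
  by rewrite leq_mul // ltnW // ltn_expl.
rewrite -expnD leq_exp2l // -expnM.
apply: leq_trans (_ : 2 ^ X.+1 <= _); first by rewrite expnS mul2n -addnn leq_add2r.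
by rewrite leq_exp2l //; apply: leq_trans hX _; rewrite leq_pmulr.
Qed.

Lemma brauer_upto_bound r s : 0 < r -> brauer_upto r s (brauer_bound r s).
Proof.
move=> r0.
have pos t : 0 < brauer_bound r t by apply: leq_trans (brauer_bound_ge r t).
have le16 t : 16 * brauer_bound r t <= brauer_bound r t.+1.
  have := brauer_bound_ge r t; rewrite /=; move: (brauer_bound r t) => u hu.
  have u2 : 2 <= u.
    by apply: leq_trans hu; rewrite ltnS muln_gt0 !expn_gt0 addnS.
  apply: leq_trans (_ : 2 ^ 4 * 2 ^ u <= _); first by rewrite leq_mul // ltnW // ltn_expl.
  by rewrite -expnD leq_exp2l //; rewrite !expnS expn0 muln1; nia.
(* The step draws on two previous values, so consecutive ones are proved together. *)
suff : brauer_upto r s (brauer_bound r s) /\ brauer_upto r s.+1 (brauer_bound r s.+1).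
  by case.
elim: s => [|s [IH1 IH2]]; [split|split=> //].
- move=> c J; rewrite leqn0 cards_eq0 => /eqP -> /(_ 1); rewrite inE.
  by move=> h; have := h (pos 0).
(* With one colour only the dominant case occurs, so [M] and [e] can be 0. *)
- apply: (@brauer_step r 0 0 (brauer_bound r 0) _ 0) => //.
  move=> c J; rewrite leqn0 cards_eq0 => /eqP -> /(_ 1); rewrite inE.
  by move=> h; have := h (pos 0).
(* This exponent works because $8r\le 2^{3+r}$. *)
apply: (@brauer_step r s.+1 (brauer_bound r s) (brauer_bound r s.+1) _
  ((3 + r) * (brauer_bound r s * 2))) => //.
  exact: roth_length_two_steps (brauer_bound_ge r s).
rewrite [leqRHS]expnM leq_exp2r ?muln_gt0 ?pos // mulnA expnD.
by rewrite leq_mul // ltnW // ltn_expl.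
Qed.

(** * The tower bound *)

Lemma ltn_Tow n : n < Tow n.
Proof. by elim: n => //= n IH; apply: leq_trans (ltn_expl _ _). Qed.

(** The induction carries $3b^3+2$ so that the cube stays under the tower: for $b'=2^{b^3}$,
    $3b'^3+2\le 4\cdot 2^{3b^3}=2^{3b^3+2}$. *)
Lemma brauer_bound_Tow r s h : 3 * brauer_bound r 0 ^ 3 + 2 <= Tow h ->
  brauer_bound r s <= Tow (s + h).
Proof.
move=> h0; suff h3 : 3 * brauer_bound r s ^ 3 + 2 <= Tow (s + h).
  apply: leq_trans h3; apply: leq_trans (leq_addr _ _).
  apply: leq_trans (leq_pmull _ _) => //.
  by case: (brauer_bound r s) => // u; rewrite -{1}[u.+1]expn1 leq_pexp2l.
elim: s => // s IH.
rewrite addSn [Tow _.+1]/= [brauer_bound r s.+1]/= -expnM (mulnC _ 3).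
apply: leq_trans (leq_pexp2l (isT : 0 < 2) IH); rewrite expnD.
have u0 : 0 < brauer_bound r s by apply: leq_trans (brauer_bound_ge r s).
have : 2 <= 2 ^ (3 * brauer_bound r s ^ 3).
  by rewrite -{1}[2]expn1 leq_exp2l // muln_gt0 expn_gt0 u0.
move: (2 ^ _) => x; lia.
Qed.

(* [Tow n > n] gives [Tow (n + 1) > 2^n], so a logarithmic excess dominates the
   polynomial in [r] from which the recursion starts. *)
Definition tower_excess (r : nat) : nat := 80 + 6 * trunc_log 2 r.

Lemma tower_excess_ge r : 0 < r -> 3 * brauer_bound r 0 ^ 3 + 2 <= Tow (tower_excess r).
Proof.
move=> r0; rewrite /tower_excess; set t := trunc_log 2 r.
have rt : r <= 2 ^ t.+1 by apply: ltnW; apply: trunc_log_ltn.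
have h7 : 2 * r + 7 <= 2 ^ (t + 5).
  apply: leq_trans (_ : 2 ^ 4 * 2 ^ t.+1 <= _); last by rewrite -expnD leq_exp2l //; lia.
  have := leq_mul (leqnn 9) rt; lia.
have hb : brauer_bound r 0 <= 2 ^ (23 + 2 * t).
  apply: leq_trans (_ : 2 ^ 12 * (2 ^ (t + 5)) ^ 2 + 2 ^ 12 * (2 ^ (t + 5)) ^ 2 <= _).
    rewrite /brauer_bound -addn1 leq_add //; last by rewrite muln_gt0 !expn_gt0.
    by rewrite leq_mul2l leq_exp2r // h7 orbT.
  by rewrite addnn -mul2n -expnM -expnD -expnS leq_exp2l //; lia.
apply: leq_trans (_ : 2 ^ (79 + 6 * t) <= _); last first.
  by rewrite addSn /= leq_exp2l // ltnW // ltn_Tow.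
apply: leq_trans (_ : 4 * (2 ^ (23 + 2 * t)) ^ 3 + 4 * (2 ^ (23 + 2 * t)) ^ 3 <= _).
  apply: leq_add; first by rewrite leq_mul // leq_exp2r.
  by rewrite -{1}[2]muln1 leq_mul // !expn_gt0.
rewrite addnn -mul2n mulnA -[2 * 4]/(2 ^ 3) -expnM -expnD leq_exp2l //; lia.
Qed.

(** Since $\log^2 r=O(r)$, the square of excess over [r] is $O(1/r)$; squaring avoids roots and real
    logarithms. *)
Lemma tower_excess_sqr r : 0 < r -> tower_excess r ^ 2 <= 2 ^ 16 * r.
Proof.
move=> r0; rewrite /tower_excess; set t := trunc_log 2 r.
have tr : 2 ^ t <= r by apply: trunc_logP.
have t2 : t ^ 2 <= 4 * 2 ^ t.
  elim: t {tr} => // t IH.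
  have : t < 2 ^ t by apply: ltn_expl.
  by move: IH; rewrite expnS !expnS !expn0 !muln1; lia.
have h : t ^ 2 <= 4 * r by lia.
apply: leq_trans (_ : (2 ^ 7 + 2 ^ 3 * t) ^ 2 <= _).
  by rewrite leq_exp2r // leq_add // leq_mul.
have [h1 h2] : (2 ^ 7) ^ 2 <= 2 ^ 14 * r /\ (2 ^ 3 * t) ^ 2 <= 2 ^ 14 * r.
  split; first by rewrite -expnM leq_pmulr.
  rewrite expnMn -expnM; apply: leq_trans (leq_mul (leqnn _) h) _.
  by rewrite mulnA leq_mul2r -[4]/(2 ^ 2) -expnD leq_exp2l ?orbT.
have hC := leq_of_leqif (nat_Cauchy (2 ^ 7) (2 ^ 3 * t)).
have -> : 2 ^ 16 * r = 2 * (2 * (2 ^ 14 * r)) by rewrite !(expnS 2 _.+1) -!mulnA.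
rewrite sqrnD; move: (2 ^ 7) (2 ^ 3 * t) (2 ^ 14 * r) h1 h2 hC => x y w.
by move=> h1 h2 hC; lia.
Qed.

(** * The error term and the final bound *)

Local Open Scope classical_set_scope.
Local Open Scope ring_scope.

Lemma tower_excess_cvg (R : realType) :
  ((tower_excess n)%:R / n%:R : R) @[n --> \oo] --> (0 : R).
Proof.
apply/cvgr0Pnorm_lt => /= e e0; near=> n.
have n0 : (0 < n)%N by near: n; exists 1%N.
have nR : 0 < n%:R :> R by rewrite ltr0n.
have ne : (2 ^ 16)%N%:R / e ^+ 2 < n%:R by near: n; apply: nbhs_infty_gtr.
rewrite ger0_norm ?divr_ge0 ?ler0n // -(@ltr_pXn2r _ 2) ?nnegrE ?divr_ge0 ?ler0n ?ltW //.
rewrite ltr_pdivrMr ?exprn_gt0 // in ne.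
rewrite expr_div_n ltr_pdivrMr ?exprn_gt0 //.
apply: le_lt_trans (_ : (2 ^ 16 * n)%N%:R < _).
  by rewrite -natrX ler_nat tower_excess_sqr.
by rewrite natrM expr2 mulrA ltr_pM2r // mulrC.
Unshelve. all: by end_near. Qed.

Theorem theorem1p4 (R : realType) :
  exists eps : nat -> R,
    (eps n @[n --> \oo] --> (0 : R)) /\
    forall r : nat, (0 < r)%N ->
      exists m : nat,
        [/\ (0 < m)%N,
            (1 + eps r) * r%:R = m%:R
          & exists2 B : nat, is_brauer_number r B & (B <= Tow m)%N].
Proof.
(* With this choice $(1+\varepsilon(r))r$ is the natural number [r + tower_excess r]. *)
exists (fun n => (tower_excess n)%:R / n%:R); split; first exact: tower_excess_cvg.
move=> r r0; exists (r + tower_excess r)%N; split; first by rewrite addn_gt0 r0.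
  by rewrite natrD mulrDl mul1r divfK // pnatr_eq0 -lt0n.
have bound : every_colouring_has_brauer r (brauer_bound r r).
  move=> c; apply: (@brauer_upto_bound r r r0 c [set: 'I_r]%SET).
    by rewrite cardsT card_ord.
  by move=> x _; rewrite inE.
pose P N := `[< (0 < N)%N /\ every_colouring_has_brauer r N >].
have PB : P (brauer_bound r r).
  apply/asboolP; split; last exact: bound.
  exact: leq_trans (brauer_bound_ge r r).
have exP : exists N, P N by exists (brauer_bound r r).
case: (ex_minnP exP) => B /asboolP [B0 hB] minB; exists B.
  by split=> // N N0 hN; apply: minB; apply/asboolP.
exact: leq_trans (minB _ PB) (brauer_bound_Tow r (tower_excess_ge r0)).
Qed.
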